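(* Let $\mathbf{Z}$ be a random vector in $\mathbb{R}^k$ with distribution $\mathrm{P}$ that is absolutely continuous with respect to Lebesgue measure on $\mathbb{R}^k$, with a density that has connected support, and that admits finite first-order moments. Then, for all $\tau\in[0,1)$, the $\tau$-quantile region and the halfspace depth region of order $\tau$ coincide: $R(\tau)=D(\tau)$.
   Context: A prime denotes transpose. $\mathcal{S}^{k-1}$ is the unit sphere of $\mathbb{R}^k$. The check function is $\rho_\tau(x):=x(\tau-\mathbb{I}_{[x<0]})$. For $\mathbf{u}\in\mathcal{S}^{k-1}$, $\boldsymbol{\Gamma}_{\mathbf{u}}$ is an arbitrary $k\times(k-1)$ matrix such that $(\mathbf{u}\,\vdots\,\boldsymbol{\Gamma}_{\mathbf{u}})$ is orthogonal (its choice does not affect the halfspaces below). Quantile halfspaces: for $\boldsymbol{\tau}=\tau\mathbf{u}$ with $\tau\in(0,1)$, $\mathbf{u}\in\mathcal{S}^{k-1}$, and any minimizer $(a_{\boldsymbol{\tau}},\mathbf{b}_{\boldsymbol{\tau}}')'$ over $\mathbb{R}\times\mathbb{R}^{k-1}$ of $\Psi_{\boldsymbol{\tau}}(a,\mathbf{b}):=\mathrm{E}[\rho_\tau(\mathbf{u}'\mathbf{Z}-\mathbf{b}'\boldsymbol{\Gamma}_{\mathbf{u}}'\mathbf{Z}-a)]$, the (closed) upper $\boldsymbol{\tau}$-quantile halfspace is $H^+_{\boldsymbol{\tau}}:=\{\mathbf{z}\in\mathbb{R}^k:\mathbf{u}'\mathbf{z}\ge\mathbf{b}_{\boldsymbol{\tau}}'\boldsymbol{\Gamma}_{\mathbf{u}}'\mathbf{z}+a_{\boldsymbol{\tau}}\}$.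 (Under the stated assumptions the minimizer, hence $H^+_{\boldsymbol{\tau}}$, is unique.) Quantile regions: for $\tau\in(0,1)$, $R(\tau):=\bigcap_{\mathbf{u}\in\mathcal{S}^{k-1}}\bigcap\{H^+_{\tau\mathbf{u}}\}$, where $\bigcap\{H^+_{\tau\mathbf{u}}\}$ is the intersection of the collection of all upper $(\tau\mathbf{u})$-quantile halfspaces (over all minimizers); and $R(0):=\mathbb{R}^k$. Halfspace (Tukey) depth: $HD(\mathbf{z},\mathrm{P}):=\inf\{\mathrm{P}[H]:H\text{ is a closed halfspace containing }\mathbf{z}\}$, and $D(\tau):=\{\mathbf{z}\in\mathbb{R}^k:HD(\mathbf{z},\mathrm{P})\ge\tau\}$ for $\tau\in[0,1]$. *)

(* Defs.v *)
From HB Require Import structures.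
From mathcomp Require Import all_boot all_order all_algebra.
From mathcomp Require Import all_classical all_reals all_analysis.

Set Implicit Arguments.
Unset Strict Implicit.
Unset Printing Implicit Defensive.

Import Order.TTheory GRing.Theory Num.Theory.
Import numFieldNormedType.Exports.

Local Open Scope classical_set_scope.
Local Open Scope ring_scope.

(* R^k is the type 'cV[R]_k of column vectors, with the library's topology on
   matrices.  As the library does for tuples, its Borel sigma-algebra is
   presented as the one generated by the k coordinates. *)

Definition cV_display : measure_display.
Proof. exact: default_measure_display. Qed.

Section borel_cV.
Context {R : realType} (k : nat).

Definition cV_coord (i : 'I_k) (x : 'cV[R]_k) : R := x i ord0.

Let cV_set0 : g_sigma_preimage cV_coord set0.
Proof. exact: sigma_algebra0. Qed.

Let cV_setC A : g_sigma_preimage cV_coord A -> g_sigma_preimage cV_coord (~` A).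
Proof. exact: sigma_algebraC. Qed.

Let cV_bigcup (F : _^nat) : (forall i, g_sigma_preimage cV_coord (F i)) ->
  g_sigma_preimage cV_coord (\bigcup_i (F i)).
Proof. exact: sigma_algebra_bigcup. Qed.

HB.instance Definition _ := @isMeasurable.Build cV_display
  'cV[R]_k (g_sigma_preimage cV_coord) cV_set0 cV_setC cV_bigcup.

Lemma measurable_cV_coord (i : 'I_k) : measurable_fun [set: 'cV[R]_k] (cV_coord i).
Proof.
move=> _ Y mY; rewrite setTI; apply: sub_sigma_algebra => /=.
rewrite -bigcup_seq/=; exists i => /=; first by rewrite mem_index_enum.
by exists Y => //; rewrite setTI.
Qed.

Lemma measurable_fun_cV d (T : measurableType d) (f : T -> 'cV[R]_k) :
  (forall i, measurable_fun [set: T] (cV_coord i \o f)) ->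
  measurable_fun [set: T] f.
Proof.
move=> mf; suff prefS : g_sigma_preimage (fun i => cV_coord i \o f) `<=` measurable.
  by move: prefS; rewrite g_sigma_preimage_comp => prefS _ A mA; apply: prefS; exists A.
apply: smallest_sub; first exact: sigma_algebra_measurable.
rewrite -bigcup_seq => A [i _ [B mB <-]]; exact: mf.
Qed.

End borel_cV.

(* Lebesgue measure on R^(k+1) is the product of the Lebesgue measures on R and
   R^k, carried to column vectors by (a, x) |-> (a, x_1, ..., x_k)'. *)

Section lebesgue_cV.
Context {R : realType}.

Definition cV_cons k (p : measurableTypeR R * 'cV[R]_k) : 'cV[R]_k.+1 :=
  col_mx (p.1 : R)%:M p.2.

Definition cV_split k (x : 'cV[R]_k.+1) : measurableTypeR R * 'cV[R]_k :=
  (x ord0 ord0, dsubmx (x : 'cV[R]_(1 + k))).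

Lemma cV_consK k : cancel (@cV_cons k) (@cV_split k).
Proof.
move=> [a x]; rewrite /cV_split/= /cV_cons/= col_mxKd; congr pair.
have -> : (ord0 : 'I_k.+1) = lshift k (ord0 : 'I_1) by exact/val_inj.
by rewrite (col_mxEu (a%:M : 'M[R]_1)) mxE eqxx mulr1n.
Qed.

Lemma cV_cons0 k a (x : 'cV[R]_k) : cV_coord ord0 (cV_cons (a, x)) = a.
Proof. exact: (congr1 fst (cV_consK (a, x))). Qed.

Lemma cV_consS k a (x : 'cV[R]_k) (i : 'I_k) :
  cV_coord (lift ord0 i) (cV_cons (a, x)) = cV_coord i x.
Proof.
rewrite /cV_coord /cV_cons /=.
have -> : (lift ord0 i : 'I_k.+1) = rshift 1 i by exact/val_inj.
by rewrite (col_mxEd (a%:M : 'M[R]_1)).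
Qed.

Lemma measurable_cV_cons k : measurable_fun setT (@cV_cons k).
Proof.
apply: measurable_fun_cV => i; case: (unliftP ord0 i) => [j|] ->.
  rewrite (_ : _ \o _ = cV_coord j \o snd); last first.
    by apply/funext => -[a x]; exact: cV_consS.
  by apply: measurableT_comp => //; exact: measurable_cV_coord.
rewrite (_ : _ \o _ = fst); last by apply/funext => -[a x]; exact: cV_cons0.
exact: measurable_fst.
Qed.

Lemma measurable_cV_split k : measurable_fun setT (@cV_split k).
Proof.
apply: measurable_fun_pair; first exact: (@measurable_cV_coord R k.+1 ord0).
apply: measurable_fun_cV => i.
rewrite (_ : _ \o _ = cV_coord (lift ord0 i)); first exact: measurable_cV_coord.
apply/funext => x; rewrite /cV_coord /= mxE; congr (x _ _); exact/val_inj.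
Qed.

HB.instance Definition _ k := isMeasurableFun.Build _ _ _ _
  (@cV_cons k) (@measurable_cV_cons k).

Section step.
Context (k : nat) (mu : {sigma_finite_measure set 'cV[R]_k -> \bar R}).

Definition lebesgue_cons : set 'cV[R]_k.+1 -> \bar R :=
  pushforward (@lebesgue_measure R \x mu)%E (@cV_cons k).

Let lebesgue_cons0 : lebesgue_cons set0 = 0%E.
Proof. by rewrite /lebesgue_cons /pushforward preimage_set0 measure0. Qed.

Let lebesgue_cons_ge0 A : (0 <= lebesgue_cons A)%E.
Proof. exact: measure_ge0. Qed.

Let lebesgue_cons_sigma_additive : semi_sigma_additive lebesgue_cons.
Proof. exact: measure_semi_sigma_additive. Qed.

HB.instance Definition _ := isMeasure.Build _ _ _ lebesgue_cons
  lebesgue_cons0 lebesgue_cons_ge0 lebesgue_cons_sigma_additive.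

Let lebesgue_cons_sigma_finite : sigma_finite setT lebesgue_cons.
Proof.
have /sigma_finiteP[F [FT ndF Foo]] := sigma_finiteT (@lebesgue_measure R).
have /sigma_finiteP[G [GT ndG Goo]] := sigma_finiteT mu.
exists (fun n => @cV_split k @^-1` (F n `*` G n)).
  rewrite -preimage_bigcup (_ : \bigcup_n _ = setT) ?preimage_setT//.
  rewrite -subTset => -[a x] _.
  have [n _ Fa] : (\bigcup_n F n) a by rewrite -FT.
  have [m _ Gx] : (\bigcup_n G n) x by rewrite -GT.
  exists (maxn n m) => //; split => /=.
    by move: a Fa; exact/subsetPset/ndF/leq_maxl.
  by move: x Gx; exact/subsetPset/ndG/leq_maxr.
move=> n; have [mF Fn] := Foo n; have [mG Gn] := Goo n; split.
  rewrite -[X in measurable X]setTI; apply: measurable_cV_split => //.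
  exact: measurableX.
rewrite /lebesgue_cons /pushforward -comp_preimage.
rewrite (_ : @cV_split k \o @cV_cons k = id); last first.
  by apply/funext => p; exact: cV_consK.
by rewrite preimage_id product_measure1E// lte_mul_pinfty// ge0_fin_numE.
Qed.

HB.instance Definition _ := @Measure_isSigmaFinite.Build _ _ _
  lebesgue_cons lebesgue_cons_sigma_finite.

End step.

(* R^0 is a single point, of mass 1 *)
Fixpoint lebesgue_cV k : {sigma_finite_measure set 'cV[R]_k -> \bar R} :=
  if k isn't k'.+1 then dirac (0 : 'cV[R]_0) else lebesgue_cons (lebesgue_cV k').

Lemma measurable_cV_box k (A : 'I_k -> set R) :
  (forall i, measurable (A i)) ->
  measurable [set x : 'cV[R]_k | forall i, A i (cV_coord i x)].
Proof.
move=> mA; rewrite (_ : mkset _ = \bigcap_(i in [set` index_enum 'I_k])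
  (cV_coord i @^-1` A i)).
  rewrite bigcap_seq; apply: bigsetI_measurable => i _.
  by rewrite -[X in measurable X]setTI; exact: measurable_cV_coord.
apply/seteqP; split => x /= Ax i => [_|]; first exact: Ax.
by apply: Ax; rewrite /= mem_index_enum.
Qed.

Lemma lebesgue_cV_box k (A : 'I_k -> set R) : (forall i, measurable (A i)) ->
  lebesgue_cV k [set x | forall i, A i (cV_coord i x)] =
  (\prod_(i < k) @lebesgue_measure R (A i))%E.
Proof.
elim: k A => [|k IH] A mA.
  by rewrite big_ord0 /= diracE mem_set// => -[].
rewrite big_ord_recl -IH// -product_measure1E; first last.
- by apply: (@measurable_cV_box k (A \o lift ord0)) => i; exact: mA.
- exact: mA.
rewrite /= /lebesgue_cons /pushforward; congr product_measure1.
apply/seteqP; split => -[a x] /= Ax.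
  split; first by have := Ax ord0; rewrite cV_cons0.
  by move=> i; have := Ax (lift ord0 i); rewrite cV_consS.
move=> i; case: (unliftP ord0 i) => [j|] ->; first by rewrite cV_consS; apply: Ax.2.
by rewrite cV_cons0; exact: Ax.1.
Qed.

End lebesgue_cV.

Section densities.
Context {R : realType} {k : nat}.
Implicit Types (mu : set 'cV[R]_k -> \bar R) (f : 'cV[R]_k -> R).

Definition is_density mu f :=
  [/\ measurable_fun setT f, forall x, 0 <= f x &
      forall A, measurable A ->
        mu A = (\int[lebesgue_cV k]_(x in A) (f x)%:E)%E].

(* A density is only defined up to Lebesgue-null sets, so its support is the
   complement of the largest open set on which it vanishes almost everywhere.
   The closure of [set x | f x != 0] would depend on the version of f. *)
Definition density_support f : set 'cV[R]_k :=
  [set x | forall U, nbhs x U ->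
    ~ (lebesgue_cV k).-negligible (U `&` [set y | f y != 0])].

End densities.

Section halfspaces.
Context {R : realType} {k : nat}.

Definition dotv (u v : 'cV[R]_k) : R := (u^T *m v) ord0 ord0.

(* The library's norm on matrices is the sup norm, hence the use of dotv. *)
Definition unit_sphere : set 'cV[R]_k := [set u | dotv u u = 1].

Definition orthogonal_mx (M : 'M[R]_k) := M^T *m M = 1%:M.

Definition closed_halfspace (H : set 'cV[R]_k) :=
  exists (c : 'cV[R]_k) (a : R), c != 0 /\ H = [set z | a <= dotv c z].

Definition halfspace_depth (mu : set 'cV[R]_k -> \bar R) (z : 'cV[R]_k) : \bar R :=
  ereal_inf [set mu H | H in [set H | closed_halfspace H /\ H z]].

Definition depth_region (mu : set 'cV[R]_k -> \bar R) (tau : R) : set 'cV[R]_k :=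
  [set z | (tau%:E <= halfspace_depth mu z)%E].

End halfspaces.

Definition check_function {R : realType} (tau x : R) : R :=
  x * (tau - (x < 0)%R%:R).

(* The ambient space is R^(k+1), so that the matrices Gamma_u are (k+1) x k. *)
Section quantile_regions.
Context {R : realType} {k : nat} {d : measure_display} {T : measurableType d}
  (P : probability T R) (Z : T -> 'cV[R]_k.+1).
Implicit Types (tau a : R) (u : 'cV[R]_k.+1) (G : 'M[R]_(k.+1, k))
  (b : 'cV[R]_k).

Definition quantile_objective tau u G a b : \bar R :=
  'E_P[fun w => check_function tau (dotv u (Z w) - dotv b (G^T *m Z w) - a)]%E.

Definition quantile_minimizer tau u G : set (R * 'cV[R]_k) :=
  [set ab | forall a b, (quantile_objective tau u G ab.1 ab.2 <=
                         quantile_objective tau u G a b)%E].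

Definition upper_halfspace u G a b : set 'cV[R]_k.+1 :=
  [set z | dotv b (G^T *m z) + a <= dotv u z].

Definition quantile_region (Gamma : 'cV[R]_k.+1 -> 'M[R]_(k.+1, k)) tau :
    set 'cV[R]_k.+1 :=
  if tau == 0 then setT else
  \bigcap_(u in unit_sphere)
    \bigcap_(ab in quantile_minimizer tau u (Gamma u))
      upper_halfspace u (Gamma u) ab.1 ab.2.

End quantile_regions.

(* Main.v *)
(* Write c = u - Gamma_u b, so that a quantile halfspace is {z | a <= c.z}.
   D(tau) <= R(tau): minimality in a alone makes P[c.Z < a'] <= tau for every
   a' < a.  If c.z < a, the halfspace {x | c.x <= c.z} has mass at least tau, so
   the slab c.z < c.x < a' is null, which contradicts the connectedness of the
   support.
   R(tau) <= D(tau): let c be the normal of a halfspace {x | c.x <= t} of mass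
   less than tau, and let a > t satisfy P[c.Z < a] = tau.  Put
   W = E[(tau - 1[c.Z < a]) Z].  Then c.W = E[rho_tau(c.Z - a)] > 0, and for
   u = W/|W| the pair (a, c)/(u.c) satisfies the first-order conditions of the
   convex problem, so {z | a <= c.z} is an upper (tau u)-quantile halfspace
   disjoint from {x | c.x <= t}. *)
Require Import Defs.
From HB Require Import structures.
From mathcomp Require Import all_boot all_order all_algebra.
From mathcomp Require Import all_classical all_reals all_analysis.
From mathcomp Require Import measurable_realfun ring lra.

Import Order.TTheory GRing.Theory Num.Theory.
Import numFieldNormedType.Exports.

Local Open Scope classical_set_scope.
Local Open Scope ring_scope.

Set Implicit Arguments.
Unset Strict Implicit.
Unset Printing Implicit Defensive.

(** * The inner product on column vectors *)

Section dotv_theory.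
Context {R : realType} {k : nat}.
Implicit Types (u v w : 'cV[R]_k) (a : R).

Lemma dotvE u v : dotv u v = \sum_i u i ord0 * v i ord0.
Proof. by rewrite /dotv mxE; apply: eq_bigr => i _; rewrite mxE. Qed.

Lemma dotvC u v : dotv u v = dotv v u.
Proof. by rewrite !dotvE; apply: eq_bigr => i _; rewrite mulrC. Qed.

Lemma dotvDl u v w : dotv (u + v) w = dotv u w + dotv v w.
Proof. by rewrite /dotv linearD mulmxDl mxE. Qed.

Lemma dotvZl a u v : dotv (a *: u) v = a * dotv u v.
Proof. by rewrite /dotv linearZ -scalemxAl mxE. Qed.

Lemma dotvNl u v : dotv (- u) v = - dotv u v.
Proof. by rewrite -scaleN1r dotvZl mulN1r. Qed.

Lemma dotvBl u v w : dotv (u - v) w = dotv u w - dotv v w.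
Proof. by rewrite dotvDl dotvNl. Qed.

Lemma dotvZr a u v : dotv u (a *: v) = a * dotv u v.
Proof. by rewrite dotvC dotvZl dotvC. Qed.

Lemma dotv0l v : dotv 0 v = 0.
Proof. by rewrite -(scale0r v) dotvZl mul0r. Qed.

Lemma dotv_ge0 u : 0 <= dotv u u.
Proof. by rewrite dotvE sumr_ge0// => i _; rewrite -expr2 sqr_ge0. Qed.

Lemma dotv_eq0 u : (dotv u u == 0) = (u == 0).
Proof.
apply/idP/idP => [|/eqP ->]; last by rewrite dotv0l.
rewrite dotvE psumr_eq0 => [|i _]; last by rewrite -expr2 sqr_ge0.
move=> /allP u0; apply/eqP/colP => i; rewrite mxE.
by have := u0 i (mem_index_enum _); rewrite mulf_eq0 orbb => /eqP.
Qed.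

Lemma dotv_mulmx n (G : 'M[R]_(k, n)) (b : 'cV[R]_n) v :
  dotv b (G^T *m v) = dotv (G *m b) v.
Proof. by rewrite /dotv trmx_mul mulmxA. Qed.

Lemma continuous_dotv u : continuous (dotv u).
Proof.
rewrite (_ : dotv u = fun v => \sum_i u i ord0 * v i ord0); last first.
  by apply/funext => v; rewrite dotvE.
refine (@continuous_big _ _ +%R 0 xpredT _ _ _ _ _); first exact: add_continuous.
move=> i _ v; apply: (@continuousM _ _ (cst (u i ord0)) (fun v => v i ord0)).
  exact: cst_continuous.
exact: coord_continuous.
Qed.

Lemma measurable_dotv u : measurable_fun setT (dotv u).
Proof.
rewrite (_ : dotv u = fun v => \sum_i u i ord0 * v i ord0); last first.
  by apply/funext => v; rewrite dotvE.
apply: measurable_sum => i; apply: measurable_funM => //.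
exact: measurable_cV_coord.
Qed.

End dotv_theory.

(** * Halfspaces and hyperplanes under Lebesgue measure *)

Lemma measurable_halfspace {R : realType} k (c : 'cV[R]_k) (A : set R) :
  measurable A -> measurable (dotv c @^-1` A).
Proof.
by move=> mA; rewrite -[X in measurable X]setTI; exact: measurable_dotv.
Qed.

(** Induction on the dimension. If the tail [c'] of the normal is nonzero, each section at a fixed
    first coordinate is a null hyperplane; otherwise the set is a point times the whole space, null
    because zero times infinity is zero. *)
Lemma lebesgue_hyperplane {R : realType} k (c : 'cV[R]_k) a : c != 0 ->
  lebesgue_cV k [set x | dotv c x = a] = 0%E.
Proof.
elim: k c a => [c a|k IH c a c0]; first by rewrite flatmx0 eqxx.
pose c' : 'cV[R]_k := dsubmx (c : 'cV[R]_(1 + k)).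
have cE (t : R) x : dotv c (cV_cons (t, x)) = c ord0 ord0 * t + dotv c' x.
  rewrite !dotvE big_ord_recl; congr +%R.
    by congr (_ * _); exact: (cV_cons0 t x).
  apply: eq_bigr => i _; congr (_ * _); last exact: (cV_consS t x i).
  by rewrite !mxE; congr (c _ _); exact/val_inj.
rewrite /= /lebesgue_cons /pushforward.
rewrite [X in product_measure1 _ _ X](_ : _ =
  [set p | c ord0 ord0 * p.1 + dotv c' p.2 = a]); last first.
  by apply/seteqP; split => -[t x] /=; rewrite cE.
have [c'0|c'0] := eqVneq c' 0; last first.
  apply: integral0_eq => t _ /=.
  rewrite (_ : xsection _ _ = [set x | dotv c' x = a - c ord0 ord0 * t]) ?IH//.
  apply/seteqP; split => x; rewrite /xsection /= inE /=; lra.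
have c00 : c ord0 ord0 != 0.
  apply: contra c0 => /eqP c00; apply/eqP/colP => i; rewrite mxE.
  case: (unliftP ord0 i) => [j ->|->//].
  move/colP : c'0 => /(_ j); rewrite !mxE => <-; congr (c _ _); exact/val_inj.
rewrite (_ : mkset _ = [set a / c ord0 ord0] `*` setT).
  rewrite product_measure1E//.
  by have /= -> := lebesgue_measure_set1 (a / c ord0 ord0); rewrite mul0e.
apply/seteqP; split => -[t x] /=; rewrite c'0 dotv0l addr0.
  by move=> <-; split => //; field.
by move=> [-> _]; field.
Qed.

(** * The support of a density *)

Section support.
Context {R : realType} {k : nat}.
Variables (mu : {measure set 'cV[R]_k -> \bar R}) (f : 'cV[R]_k -> R).
Hypothesis muf : is_density mu f.

(** As [f] is nonnegative, [mu A] is the integral of |f| over [A], which vanishes exactly when [f]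
    is zero almost everywhere on [A]. This ties null sets to the definition of the support. *)
Lemma is_density_null A : measurable A ->
  mu A = 0%E <-> (lebesgue_cV k).-negligible (A `&` [set x | f x != 0]).
Proof.
move=> mA; have [mf f0 muE] := muf; rewrite muE//.
have mfA : measurable_fun A (EFin \o f).
  by apply/measurable_EFinP; exact: measurable_funTS.
rewrite (eq_integral (fun x => `|(EFin \o f) x|%E)); last first.
  by move=> x _; rewrite /= ger0_norm.
rewrite (ae_eq_integral_abs _ mA mfA) /ae_eq /= /prop_near1 /=.
have -> // : A `&` [set x | f x != 0] = ~` [set x | A x -> (f x)%:E = 0%E].
apply/seteqP; split => x /=.
  by move=> [Ax fx0] /(_ Ax) [] fx; rewrite fx eqxx in fx0.
by move=> /not_implyP[Ax fx]; split => //; apply/eqP => fx0; apply: fx; rewrite fx0.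
Qed.

(** A ball of the sup norm is a box, and boxes belong to the sigma-algebra generated by the
    coordinates. *)
Lemma measurable_mx_ball (x : 'cV[R]_k) (e : R) : measurable (ball x e).
Proof.
have [e0|e0] := leP e 0.
  rewrite (_ : ball x e = set0)//; apply/seteqP; split => // y [].
  by rewrite ltNge e0.
rewrite (_ : ball x e = [set y | forall i, ball (x i ord0) e (cV_coord i y)]).
  apply: (@measurable_cV_box R k (fun i => ball (x i ord0) e)) => i.
  exact: measurable_ball.
apply/seteqP; split => [y [_ xy] i|y xy]; first exact: xy.
by split => // i j; rewrite (ord1 j); exact: xy.
Qed.

(* Lindelof: the complement of the support is covered by the countably many
   null balls with rational centre and radius 1/(n+1). *)
Lemma meets_support A : measurable A -> mu A != 0%E ->
  exists2 x, A x & density_support f x.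
Proof.
move=> mA muA; apply: contrapT => nA; move/negP : muA; apply.
pose B (p : 'cV[rat]_k * nat) : set 'cV[R]_k :=
  ball (map_mx ratr p.1 : 'cV[R]_k) p.2.+1%:R^-1.
pose F n := if @unpickle ('cV[rat]_k * nat)%type n is Some p then
  if mu (B p) == 0%E then B p else set0 else set0.
have mF n : measurable (F n).
  rewrite /F; case: (unpickle n) => [p|//]; case: ifP => // _.
  exact: measurable_mx_ball.
have F0 n : mu (F n) = 0%E.
  by rewrite /F; case: (unpickle n) => [p|//]; case: ifP => // /eqP.
have mUF : measurable (\bigcup_n F n) by exact: bigcup_measurable.
apply/eqP/(subset_measure0 mA mUF) => [x Ax|]; last first.
  apply/negligibleP => //; apply: negligible_bigcup => n.
  by apply/negligibleP => //; exact: F0.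
have /existsNP[U] : ~ density_support f x by move=> Sx; apply: nA; exists x.
move=> /not_implyP[/nbhs_ballP[e /= e0 xU]] /contrapT nU.
(* A ball of radius below [e / 2] that contains [x] lies in the [e]-ball around [x], hence in
   [U]. *)
have [n ne] : exists n, n.+1%:R^-1 < e / 2 :> R.
  have e2 : 0 < (e / 2) by rewrite divr_gt0.
  exists (Num.truncn (e / 2)^-1); rewrite invf_plt ?posrE//; exact: truncnS_gt.
have n0 : 0 < n.+1%:R^-1 :> R by [].
have q_ i : {q : rat | `|x i ord0 - ratr q| < n.+1%:R^-1}.
  apply: cid; have [|q] := @rat_in_itvoo R (x i ord0 - n.+1%:R^-1) (x i ord0 + n.+1%:R^-1).
    by rewrite ltrBlDr -addrA ltrDl addr_gt0.
  rewrite in_itv /= => qx; exists q; rewrite ltr_norml.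
  by move: qx; move: n.+1%:R^-1 => r; lra.
pose p : 'cV[rat]_k * nat := (\col_i sval (q_ i), n).
have px : ball (map_mx ratr p.1 : 'cV[R]_k) n.+1%:R^-1 x.
  split=> // i j; rewrite (ord1 j) /p /ball /= !mxE distrC; exact: (svalP (q_ i)).
have pU : B p `<=` U.
  move=> y py; apply: xU; have := ball_triangle (ball_sym px) py.
  by apply: le_ball => /=; move: ne; move: n.+1%:R^-1 => r; lra.
have muB : mu (B p) = 0%E.
  apply/is_density_null; first exact: measurable_mx_ball.
  by apply: negligibleS nU => y [/pU].
exists (pickle p) => //; by rewrite /F pickleK muB eqxx.
Qed.

(* Otherwise the support would avoid the slab while meeting both of its sides. *)
Lemma slab_gt0 c (s t : R) : connected (density_support f) -> s < t ->
  mu [set x | dotv c x <= s] != 0%E -> mu [set x | t <= dotv c x] != 0%E ->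
  mu [set x | s < dotv c x < t] != 0%E.
Proof.
move=> cS st ms mt; apply/negP => /eqP m0.
have mU (A : set R) : measurable A -> measurable [set x | A (dotv c x)].
  exact: measurable_halfspace.
have mI (i : interval R) : measurable [set x | dotv c x \in i].
  exact: (mU [set` i]).
have ms' : measurable [set x | dotv c x <= s].
  by have := mI `]-oo, s]; under eq_set do rewrite in_itv/=.
have mt' : measurable [set x | t <= dotv c x].
  by have := mI `[t, +oo[; under eq_set do rewrite in_itv/= andbT.
have mst : measurable [set x | s < dotv c x < t].
  by have := mI `]s, t[; under eq_set do rewrite in_itv/=.
have [x xs Sx] := meets_support ms' ms.
have [y yt Sy] := meets_support mt' mt.
have /connected_intervalP : connected (dotv c @` density_support f).
  apply: connected_continuous_connected => //.
  apply: continuous_subspaceT; exact: continuous_dotv.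
(* The midpoint of [s] and [t] is then the image of a support point [z], which has the slab as a
   null neighbourhood. *)
move=> /(_ (dotv c x) (dotv c y)) /(_ (imageP _ Sx) (imageP _ Sy) ((s + t) / 2)).
case; first by rewrite /= in xs yt; lra.
move=> z Sz zE; apply: (Sz [set x | s < dotv c x < t]); last exact/is_density_null.
apply: (@continuous_dotv R k c z [set r | s < r < t]).
have : nbhs (dotv c z) `]s, t[%classic.
  by apply: near_in_itvoo; rewrite in_itv /= zE; lra.
by apply: filterS => r; rewrite /= in_itv.
Qed.

End support.

(** * Existence of exact quantiles *)

Lemma cvge_near_lt {R : realType} {T} {F : set_system T} (f : T -> \bar R) l r :
  f @ F --> l -> (l < r)%E -> F [set x | (f x < r)%E].
Proof.
move=> fl lr; apply: (fl [set y | (y < r)%E]).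
by apply: open_nbhs_nbhs; split => //; exact: open_ereal_lt_ereal.
Qed.

Lemma cvge_near_gt {R : realType} {T} {F : set_system T} (f : T -> \bar R) l r :
  f @ F --> l -> (r < l)%E -> F [set x | (r < f x)%E].
Proof.
move=> fl lr; apply: (fl [set y | (r < y)%E]).
by apply: open_nbhs_nbhs; split => //; exact: open_ereal_gt_ereal.
Qed.

(** The quantile is the supremum of the points where the distribution function is below [tau]:
    continuity from below gives one inequality, right-continuity and the absence of atoms the
    other. *)
Lemma exists_quantile {R : realType} d (T : measurableType d)
    (P : probability T R) (Y : {RV P >-> R}) (tau : R) :
  (forall t, P [set w | Y w = t] = 0%E) -> 0 < tau < 1 ->
  exists a, P [set w | Y w < a] = tau%:E.
Proof.
move=> Y0 /andP[tau0 tau1].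
have tau0E : (0 < tau%:E)%E by rewrite lte_fin.
have tau1E : (tau%:E < 1)%E by rewrite lte_fin.
have mY (i : interval R) : measurable [set w | Y w \in i].
  exact: (measurable_funPTI Y (measurable_itv i)).
have mYlt t : measurable [set w | Y w < t].
  by have := mY `]-oo, t[; under eq_set do rewrite in_itv/=.
have cdfE t : cdf Y t = P [set w | Y w <= t].
  by congr (P _); apply/seteqP; split => w; rewrite /= in_itv.
pose A := [set t | (cdf Y t < tau%:E)%E].
have [t At] : A !=set0.
  have [M [_ /(_ (M - 1)) MA]] :=
    cvge_near_lt (@cvg_cdfNy0 _ _ _ P Y) tau0E.
  by exists (M - 1); apply: MA; rewrite ltrBlDr ltrDl.
have [M ubM] : has_ubound A.
  have [M [_ MA]] := cvge_near_gt (@cvg_cdfy1 _ _ _ P Y) tau1E.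
  exists (M + 1) => s As; rewrite leNgt; apply/negP => Ms.
  have := MA s (lt_trans _ Ms); rewrite ltrDl => /(_ ltr01) /=.
  by rewrite ltNge (ltW As).
have supA : has_sup A by split; [exists t | exists M].
have ltA s : s < sup A -> (cdf Y s < tau%:E)%E.
  rewrite -subr_gt0 => sA; have [r Ar] := sup_adherent sA supA.
  rewrite subKr => sr.
  by apply: le_lt_trans Ar; apply: cdf_nondecreasing; exact: ltW.
exists (sup A); apply/eqP; rewrite eq_le; apply/andP; split.
  rewrite leNgt; apply/negP => tauY.
  (* The event [Y < sup A] is the increasing union of the [F n], each of mass below [tau] since its
     threshold is less than [sup A]. *)
  pose F n := [set w | Y w <= sup A - n.+1%:R^-1].
  have FE : \bigcup_n F n = [set w | Y w < sup A].
    apply/seteqP; split => [w [n _]|w /= /ltr_add_invr[n nw]] /=.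
      by move=> /le_lt_trans; apply; rewrite ltrBlDr ltrDl.
    by exists n => //=; rewrite /F /= lerBrDr ltW.
  have mF n : measurable (F n).
    by have := mY `]-oo, sup A - n.+1%:R^-1]; under eq_set do rewrite in_itv/=.
  have : P (F n) @[n --> \oo] --> P (\bigcup_n F n).
    apply: nondecreasing_cvg_mu => //; first by rewrite FE.
    move=> m n mn; apply/subsetPset => w /= /le_trans; apply.
    by rewrite lerD2l lerN2 lef_pV2 ?posrE// ler_nat ltnS.
  rewrite FE => /cvge_near_gt /(_ tauY) [n _ /(_ n (leqnn n))] /=.
  rewrite ltNge -cdfE ltW//; apply: ltA.
  by rewrite ltrBlDr ltrDl.
have -> : P [set w | Y w < sup A] = cdf Y (sup A).
  rewrite cdfE -[LHS]adde0 -(Y0 (sup A)) -measureU//.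
  - congr (P _); apply/seteqP; split => w /=.
      by move=> [/ltW//|->].
    by rewrite le_eqVlt => /orP[/eqP|]; [right|left].
  - exact: (measurable_funPTI Y (measurable_set1 (sup A))).
  - by apply/seteqP; split => // w /= [+ Yw]; rewrite Yw ltxx.
rewrite leNgt; apply/negP => cA.
(* Right-continuity would keep the distribution function below [tau] slightly beyond [sup A]. *)
have [e e0 eA] := cvge_near_lt (@cdf_right_continuous _ _ _ P Y (sup A)) cA.
have : A (sup A + e / 2).
  apply: eA; last by rewrite ltrDl divr_gt0.
  by rewrite /ball_ /= opprD addrA subrr sub0r normrN gtr0_norm; move: e0 => /=; lra.
move=> /(ub_le_sup (ex_intro _ M ubM)); rewrite leNgt ltrDl divr_gt0//.
Qed.

(** * The check function and its expectation *)

Section check_function.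
Context {R : realType} d {T : measurableType d} (P : probability T R).
Implicit Types (tau x y a : R) (X Y : T -> R) (A : set T).

(* Equality holds at [x = y]: the bracket is a subgradient at [x]. *)
Lemma check_function_subgradient tau x y :
  y * (tau - (x < 0)%R%:R) <= check_function tau y.
Proof.
rewrite /check_function; case: (ltP x 0) => x0; case: (ltP y 0) => y0 /=; lra.
Qed.

Lemma integrable_measurable_lt X a : P.-integrable setT (EFin \o X) ->
  measurable [set w | X w < a].
Proof.
move=> /measurable_int/measurable_EFinP mX.
have := mX measurableT _ (measurable_itv `]-oo, a[).
by rewrite setTI; under eq_set do rewrite in_itv/=.
Qed.

Lemma integrableBcst X a : P.-integrable setT (EFin \o X) ->
  P.-integrable setT (EFin \o (fun w => X w - a)).
Proof.
move=> iX; have ia := finite_measure_integrable_cst P a measurableT.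
by have := integrableB measurableT iX ia.
Qed.

(** The score [tau - \1_A] is bounded by [|tau| + 1]. For [A] the event of a negative residual it is
    a subgradient of the check function. *)
Lemma integrableM_score tau X A : measurable A ->
  P.-integrable setT (EFin \o X) ->
  P.-integrable setT (EFin \o (fun w => X w * (tau - \1_A w))).
Proof.
move=> mA iX; apply: (integrableMl measurableT iX (h := fun w => tau - \1_A w)).
  by apply: measurable_funB => //; exact: measurable_indic.
exists (`|tau| + 1); split => // M tM w _ /=.
apply: le_trans (ler_normB _ _) _; apply: le_trans (ltW tM).
by rewrite lerD2l indicE; case: (_ \in _); rewrite ?normr1 ?normr0.
Qed.

Lemma check_functionE tau X w :
  check_function tau (X w) = X w * (tau - \1_[set v | X v < 0] w).
Proof.
rewrite /check_function indicE; congr (_ * (_ - (nat_of_bool _)%:R)).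
by apply/idP/idP => [?|]; rewrite inE.
Qed.

Lemma integrable_score tau A : measurable A ->
  P.-integrable setT (EFin \o (fun w => tau - \1_A w)).
Proof.
move=> mA; have itau := finite_measure_integrable_cst P tau measurableT.
by have := integrableB measurableT itau (integrable_indic P mA).
Qed.

Lemma Rintegral_score tau A : measurable A ->
  \int[P]_w (tau - \1_A w) = tau - fine (P A).
Proof.
move=> mA; rewrite RintegralB//=.
- rewrite Rintegral_cst//; have /= -> := probability_setT P.
  by rewrite mulr1 /Rintegral integral_indic// setIT.
- exact: finite_measure_integrable_cst.
- exact: integrable_indic.
Qed.

Lemma integrable_check_function tau X : P.-integrable setT (EFin \o X) ->
  P.-integrable setT (EFin \o (fun w => check_function tau (X w))).
Proof.
move=> iX; under [X in EFin \o X]eq_fun do rewrite check_functionE.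
by apply: integrableM_score => //; exact: integrable_measurable_lt.
Qed.

Lemma expectation_check_function tau X : P.-integrable setT (EFin \o X) ->
  'E_P[fun w => check_function tau (X w)]%E =
  (\int[P]_w check_function tau (X w))%:E.
Proof.
move=> iX; rewrite unlock /Rintegral fineK//.
by apply: integrable_fin_num => //; exact: integrable_check_function.
Qed.

(** With [s] the score at [b], the subgradient inequality gives E[(Y - a) s] <= E[rho(Y - a)], with
    equality when [a] is replaced by [b]. Subtracting leaves (b - a) E[s] <= 0. *)
Lemma check_minimizer_lt tau Y a b : P.-integrable setT (EFin \o Y) ->
  ('E_P[fun w => check_function tau (Y w - a)] <=
   'E_P[fun w => check_function tau (Y w - b)])%E ->
  (b - a) * (tau - fine (P [set w | Y w < b])) <= 0.
Proof.
move=> iY; have iYa t := integrableBcst t iY.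
have mYb := integrable_measurable_lt b iY.
rewrite !expectation_check_function// lee_fin => ab.
pose s w := tau - \1_[set w | Y w < b] w.
have chkb w : check_function tau (Y w - b) = (Y w - b) * s w.
  rewrite (check_functionE tau (fun w => Y w - b)) /s.
  by under [in LHS]eq_set do rewrite subr_lt0.
have le_a : \int[P]_w ((Y w - a) * s w) <= \int[P]_w check_function tau (Y w - a).
  apply: le_Rintegral => //; first exact: integrableM_score.
    exact: integrable_check_function.
  move=> w _; apply: le_trans (check_function_subgradient tau (Y w - b) _).
  by rewrite /s indicE subr_lt0 mem_setE.
have := le_trans le_a ab.
rewrite (@eq_Rintegral _ _ _ P setT _ _ (fun w _ => chkb w)).
rewrite -subr_le0 -RintegralB//; try exact: integrableM_score.
rewrite (@eq_Rintegral _ _ _ P setT (fun w => (b - a) * s w)); last by move=> w _; lra.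
by rewrite RintegralZl// ?Rintegral_score//; exact: integrable_score.
Qed.

End check_function.

(** * The normal of a quantile halfspace *)

Section halfspace_normals.
Context {R : realType} {k : nat} (G : 'M[R]_(k.+1, k)) (u : 'cV[R]_k.+1).
Hypothesis uG : orthogonal_mx (row_mx u G : 'M[R]_k.+1).

Lemma orthogonal_row_mx_cross : G^T *m u = 0.
Proof.
have : (row_mx u G)^T *m row_mx u G = (1%:M : 'M[R]_(1 + k)) := uG.
by rewrite tr_row_mx mul_col_row scalar_mx_block => /eq_block_mx[].
Qed.

(** A left inverse of a square matrix is also a right inverse, so u u' + G G' is the identity. *)
Lemma orthogonal_row_mx_decomp c : c = dotv u c *: u + G *m (G^T *m c).
Proof.
have : row_mx u G *m (row_mx u G)^T = 1%:M := mulmx1C uG.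
rewrite tr_row_mx mul_row_col => /(congr1 (mulmx^~ c)).
rewrite mul1mx mulmxDl -!mulmxA => {1}<-; congr (_ + _).
by rewrite [u^T *m c]mx11_scalar mul_mx_scalar.
Qed.

(** Lets a quantile halfspace be handled through the single normal [u - G *m b]. *)
Lemma dotv_normal c b :
  dotv u c - dotv b (G^T *m c) = dotv (u - G *m b) c.
Proof. by rewrite dotv_mulmx dotvBl. Qed.

(** Holds because [G^T *m u] vanishes. For a unit [u] it shows that the normal is nonzero. *)
Lemma dotv_normal_self b : dotv u (u - G *m b) = dotv u u.
Proof.
by rewrite dotvC -dotv_normal orthogonal_row_mx_cross [dotv b 0]dotvC dotv0l subr0.
Qed.

End halfspace_normals.

(** * First-order conditions for quantile halfspaces *)

Section quantile_halfspaces.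
Context {R : realType} {k : nat} {d : measure_display} {T : measurableType d}.
Context {P : probability T R} {Z : {RV P >-> 'cV[R]_k.+1}}.
Hypothesis Z_moments : forall i, P.-integrable setT (fun w => (Z w i ord0)%:E).

Lemma integrable_dotv c : P.-integrable setT (EFin \o (fun w => dotv c (Z w))).
Proof.
under [X in EFin \o X]eq_fun do rewrite dotvE.
rewrite (_ : EFin \o _ = fun w => (\sum_i (c i ord0)%:E * (Z w i ord0)%:E)%E).
  by apply: integrable_sum => // i _; exact: integrableZl.
by apply/funext => w; rewrite /= -sumEFin.
Qed.

Lemma Rintegral_dotv_score c tau A : measurable A ->
  \int[P]_w (dotv c (Z w) * (tau - \1_A w)) =
  dotv c (\col_i \int[P]_w (Z w i ord0 * (tau - \1_A w))).
Proof.
move=> mA; have iZ i := integrableM_score tau mA (Z_moments i).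
have -> : \int[P]_w (dotv c (Z w) * (tau - \1_A w)) =
    fine (\int[P]_w (\sum_i (c i ord0)%:E * (Z w i ord0 * (tau - \1_A w))%:E))%E.
  congr fine; apply: eq_integral => w _.
  rewrite dotvE mulr_suml -sumEFin; apply: eq_bigr => i _.
  by rewrite -EFinM mulrA.
rewrite integral_sum//; last by move=> i; exact: integrableZl (iZ i).
rewrite dotvE -sum_fine => [|i _]; last first.
  by apply: integrable_fin_num => //; exact: integrableZl (iZ i).
apply: eq_bigr => i _; rewrite mxE (integralZl measurableT (iZ i)) fineM//.
exact: integrable_fin_num (iZ i).
Qed.

Lemma quantile_objectiveE tau u G a b :
  quantile_objective P Z tau u G a b =
  'E_P[fun w => check_function tau (dotv (u - G *m b) (Z w) - a)]%E.
Proof.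
by rewrite /quantile_objective; congr expectation; apply/funext => w; rewrite dotv_normal.
Qed.

(** Obtained by varying [a] alone. For [a' < a] it bounds the mass of the open halfspace below [a']
    by [tau]. *)
Lemma quantile_minimizer_lt tau u G a b a' : quantile_minimizer P Z tau u G (a, b) ->
  (a' - a) * (tau - fine (P [set w | dotv (u - G *m b) (Z w) < a'])) <= 0.
Proof.
move=> /(_ a' b) /=; rewrite !quantile_objectiveE.
by apply: check_minimizer_lt; exact: integrable_dotv.
Qed.

(* The first-order conditions are sufficient: by convexity it is enough that 0
   is a subgradient of the objective. *)
Lemma quantile_minimizer_score tau u G a b A :
  A = [set w | dotv (u - G *m b) (Z w) < a] -> P A = tau%:E ->
  G^T *m (\col_i \int[P]_w (Z w i ord0 * (tau - \1_A w))) = 0 ->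
  quantile_minimizer P Z tau u G (a, b).
Proof.
move=> AE PA; set W := (X in G^T *m X) => GW a' b' /=.
have mA : measurable A.
  by rewrite AE; apply: integrable_measurable_lt; exact: integrable_dotv.
have iY c t := integrableBcst t (integrable_dotv c).
rewrite !quantile_objectiveE !expectation_check_function// lee_fin.
(* The value is the same for all [t] and [c]: [t] is multiplied by the mean [tau - P A] of the
   score, which is zero, and [c] meets [G^T *m W = 0]. *)
have scoreE t c : \int[P]_w ((dotv (u - G *m c) (Z w) - t) * (tau - \1_A w)) = dotv u W.
  under eq_Rintegral do rewrite mulrBl.
  rewrite RintegralB//; first last.
  - have := integrable_score P tau mA; move=> /(integrableZl measurableT t).
    by under eq_fun do rewrite -EFinM.
  - by apply: integrableM_score => //; exact: integrable_dotv.
  rewrite Rintegral_dotv_score// RintegralZl//; last exact: integrable_score.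
  rewrite Rintegral_score// PA /= subrr mulr0 subr0 -/W.
  by rewrite -dotv_normal GW [dotv c 0]dotvC dotv0l subr0.
(* [A] is the event of a negative residual at [(a, b)], so the subgradient inequality is an equality
   there. *)
have -> : \int[P]_w check_function tau (dotv (u - G *m b) (Z w) - a) = dotv u W.
  rewrite -(scoreE a b); apply: eq_Rintegral => w _.
  rewrite (check_functionE tau (fun w => dotv (u - G *m b) (Z w) - a)) AE.
  by under [in LHS]eq_set do rewrite subr_lt0.
rewrite -(scoreE a' b'); apply: le_Rintegral => //.
- exact: integrableM_score.
- exact: integrable_check_function.
move=> w _; apply: le_trans (check_function_subgradient tau (dotv (u - G *m b) (Z w) - a) _).
by rewrite AE indicE subr_lt0 mem_setE.
Qed.

(** The check function is nonnegative and vanishes only at 0. A zero integral would force [Y = 0]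
    almost surely; as that event is null, the whole space would be null too. *)
Lemma expectation_check_function_gt0 tau Y : 0 < tau < 1 ->
  P.-integrable setT (EFin \o Y) -> P [set w | Y w = 0] = 0%E ->
  0 < \int[P]_w check_function tau (Y w).
Proof.
move=> /andP[tau0 tau1] iY Y0.
have chk0 y : 0 <= check_function tau y.
  rewrite /check_function; case: ltP => y0 /=.
    by apply: mulr_le0; [exact: ltW | rewrite subr_le0 ltW].
  by rewrite subr0 mulr_ge0// ltW.
have chk_eq0 y : check_function tau y = 0 -> y = 0.
  move=> /eqP; rewrite mulf_eq0 => /orP[/eqP//|].
  by case: ltP => _ /=; [rewrite subr_eq0 lt_eqF|rewrite subr0 gt_eqF].
have iC := integrable_check_function tau iY.
rewrite lt_neqAle Rintegral_ge0// andbT eq_sym; apply/eqP => C0.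
have : (\int[P]_w `|(EFin \o (fun w => check_function tau (Y w))) w| = 0)%E.
  rewrite -[RHS]/(0%R%:E) -C0 /Rintegral fineK; last exact: integrable_fin_num.
  by apply: eq_integral => w _; rewrite /= ger0_norm.
move=> /ae_eq_integral_abs => /(_ measurableT (measurable_int _ iC)) neC.
have mY0 : measurable [set w | Y w = 0].
  have /measurable_EFinP mY := measurable_int _ iY.
  by rewrite -[X in measurable X]setTI; exact: mY (measurable_set1 0).
have : P.-negligible setT.
  apply: (negligibleS _ (negligibleU neC (proj2 (negligibleP P mY0) Y0))) => w _.
  have [Yw|Yw] := pselect (Y w = 0); [by right | left => /(_ I) [] /chk_eq0].
  exact: Yw.
move=> /(measure_negligible measurableT) /= P0.
by have := probability_setT P; rewrite P0 => /esym/eqP; rewrite onee_eq0.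
Qed.

End quantile_halfspaces.

(** Makes [dotv c \o Z] a random variable, to which [exists_quantile] applies. *)
HB.instance Definition _ {R : realType} k (c : 'cV[R]_k) :=
  isMeasurableFun.Build _ _ _ _ (dotv c) (measurable_dotv c).

(** * The two inclusions between quantile and depth regions *)

Section depth_regions.
Context {R : realType} {k : nat} {d : measure_display} {T : measurableType d}.
Variables (P : probability T R) (Z : {RV P >-> 'cV[R]_k.+1}).
Variables (Gamma : 'cV[R]_k.+1 -> 'M[R]_(k.+1, k)) (f : 'cV[R]_k.+1 -> R).
Hypothesis Gamma_orth : forall u, unit_sphere u ->
  orthogonal_mx (row_mx u (Gamma u) : 'M[R]_k.+1).
Hypothesis Z_density : is_density (distribution P Z) f.
Hypothesis Z_moments : forall i, P.-integrable setT (fun w => (Z w i ord0)%:E).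

Lemma measurable_dotv_itv c (i : interval R) : measurable [set w | dotv c (Z w) \in i].
Proof. exact: (measurable_funPTI (dotv c \o Z) (measurable_itv i)). Qed.

(** Hyperplanes are Lebesgue-null, and a law with a density does not charge Lebesgue-null sets.
    Hence projections of [Z] have no atoms, as [exists_quantile] requires. *)
Lemma distribution_hyperplane c t : c != 0 -> P [set w | dotv c (Z w) = t] = 0%E.
Proof.
move=> c0; have mH : measurable [set x | dotv c x = t].
  exact: (measurable_halfspace c (measurable_set1 t)).
apply: (proj2 (is_density_null Z_density mH)).
apply: negligibleS (@subIsetl _ _ _) _.
by apply/negligibleP => //; exact: lebesgue_hyperplane.
Qed.

Lemma depth_region_subset tau : 0 < tau < 1 -> connected (density_support f) ->
  depth_region (distribution P Z) tau `<=` quantile_region P Z Gamma tau.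
Proof.
move=> /andP[tau0 tau1] fC z Dz; rewrite /quantile_region gt_eqF// => u u1 [a b] abM.
rewrite /upper_halfspace /= -lerBrDl dotv_normal leNgt; apply/negP.
set c := u - _ *m b; set s := dotv c z => sa.
have c0 : c != 0.
  apply/eqP => c0; have := dotv_normal_self (Gamma_orth u1) b.
  by rewrite -/c c0 dotvC dotv0l u1 => /eqP; rewrite eq_sym oner_eq0.
(* Strictly between [s] and [a]: [t < a] bounds the mass below [t] by [tau], and [s < t] leaves room
   for a slab. *)
pose t := (s + a) / 2.
have mP (i : interval R) := measurable_dotv_itv c i.
have mlt r : measurable [set w | dotv c (Z w) < r].
  by have := mP `]-oo, r[; under eq_set do rewrite in_itv/=.
have mle : measurable [set w | dotv c (Z w) <= s].
  by have := mP `]-oo, s]; under eq_set do rewrite in_itv/=.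
have mst : measurable [set w | s < dotv c (Z w) < t].
  by have := mP `]s, t[; under eq_set do rewrite in_itv/=.
have Pt : (P [set w | (dotv c (Z w) < t)%R] <= tau%:E)%E.
  have := quantile_minimizer_lt Z_moments t abM; rewrite -/c nmulr_rle0; last first.
    by rewrite /t; lra.
  by rewrite subr_ge0 -lee_fin fineK// fin_num_measure.
have Ps : (tau%:E <= P [set w | (dotv c (Z w) <= s)%R])%E.
  apply: le_trans Dz _; apply: ereal_inf_lbound.
  (* [closed_halfspace] bounds the inner product from below, hence the normal [- c]. *)
  exists [set x | - s <= dotv (- c) x]; last first.
    by congr (P _); apply/seteqP; split => w /=; rewrite dotvNl lerN2.
  split; last by rewrite /= dotvNl.
  by exists (- c), (- s); rewrite oppr_eq0.
(* Both sides of the slab are charged: the lower one has mass at least [tau], the upper one at least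
   [1 - tau]. *)
have Pst : P [set w | s < dotv c (Z w) < t] != 0%E.
  apply: (slab_gt0 (mu := distribution P Z) Z_density fC); first by rewrite /t; lra.
    by rewrite gt_eqF// (lt_le_trans _ Ps).
  rewrite [X in X != _](_ : _ = P (~` [set w | dotv c (Z w) < t])); last first.
    by congr (P _); apply/seteqP; split => w /=; rewrite leNgt => /negP.
  rewrite probability_setC// gt_eqF// sube_gt0.
  by apply: le_lt_trans Pt _; rewrite lte_fin.
move: Pt; apply/negP; rewrite -ltNge.
rewrite (_ : [set w | _] = [set w | dotv c (Z w) <= s] `|` [set w | s < dotv c (Z w) < t]).
  rewrite measureU//; last first.
    by apply/seteqP; split => // w /= [ws /andP[]]; rewrite ltNge ws.
  rewrite -[tau%:E]adde0; apply: lee_ltD => //.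
  by rewrite lt0e Pst/=.
apply/seteqP; split => w /=; last first.
  by case=> [ws|/andP[]//]; apply: le_lt_trans ws _; rewrite /t; lra.
by move=> wt; case: (leP (dotv c (Z w)) s) => ws; [left|right; rewrite wt].
Qed.

Lemma quantile_region_subset tau : 0 < tau < 1 ->
  quantile_region P Z Gamma tau `<=` depth_region (distribution P Z) tau.
Proof.
move=> tau01; have /andP[tau0 tau1] := tau01.
move=> z; rewrite /quantile_region gt_eqF// => Rz.
rewrite /depth_region /= leNgt; apply/negP => /ereal_inf_lt[_ [H [HH Hz] <-]].
case: HH => c' [t [c'0 HE]]; rewrite HE in Hz * => PH {H HE}.
pose c := - c'; have c0 : c != 0 by rewrite oppr_eq0.
have [a aE] := exists_quantile (P := P) (Y := dotv c \o Z)
  (fun t => distribution_hyperplane t c0) tau01.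
pose A := [set w | dotv c (Z w) < a].
have mA : measurable A.
  by have := measurable_dotv_itv c `]-oo, a[; under eq_set do rewrite in_itv/=.
(* Otherwise [A] would be contained in the event that [Z] lies in the given halfspace, whose mass is
   below [tau]. *)
have za : dotv c z < a.
  rewrite ltNge; apply/negP => az; move: PH; apply/negP; rewrite -leNgt -aE.
  apply: le_measure; rewrite ?inE//.
    by have := measurable_dotv_itv c' `[t, +oo[; under eq_set do rewrite in_itv/= andbT.
  by move=> w /=; move: az Hz; rewrite /c /= !dotvNl; lra.
pose W := \col_i \int[P]_w (Z w i ord0 * (tau - \1_A w)).
(* The score of [A] has mean zero, so replacing [dotv c (Z w)] by [dotv c (Z w) - a] keeps the
   integral and turns it into the mean of a check function. *)
have cW : 0 < dotv c W.
  have Ya0 : P [set w | dotv c (Z w) - a = 0] = 0%E.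
    rewrite -(distribution_hyperplane a c0); congr (P _).
    by apply/seteqP; split => w /=; [move/subr0_eq|move=> ->; rewrite subrr].
  have iY := integrable_dotv Z_moments c.
  have := expectation_check_function_gt0 tau01 (integrableBcst a iY) Ya0.
  rewrite -Rintegral_dotv_score//.
  rewrite (@eq_Rintegral _ _ _ P setT
    (fun w => dotv c (Z w) * (tau - \1_A w) - a * (tau - \1_A w))); last first.
    move=> w _; rewrite -mulrBl (check_functionE tau (fun w => dotv c (Z w) - a)).
    by under [in LHS]eq_set do rewrite subr_lt0.
  have iA := integrable_score P tau mA.
  rewrite RintegralB//; first last.
  - by move: (integrableZl measurableT a iA); under eq_fun do rewrite -EFinM.
  - exact: integrableM_score.
  by rewrite RintegralZl// Rintegral_score// aE /= subrr mulr0 subr0.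
pose u := (Num.sqrt (dotv W W))^-1 *: W.
have WW : 0 < dotv W W.
  rewrite lt_neqAle dotv_ge0 eq_sym dotv_eq0 andbT; apply/eqP => W0.
  by move: cW; rewrite W0 dotvC dotv0l ltxx.
have u1 : unit_sphere u.
  rewrite /unit_sphere /= dotvZl dotvZr mulrA -invfM -expr2 sqr_sqrtr ?ltW//.
  by rewrite mulVf// gt_eqF.
have uG := Gamma_orth u1; set G := Gamma u in uG.
pose q := dotv u c.
have q0 : 0 < q by rewrite /q dotvC dotvZr mulr_gt0// invr_gt0 sqrtr_gt0.
(* Read off from c = q u + G G'c, so that [u - G *m b] is c / q. *)
pose b := - (q^-1 *: (G^T *m c)).
have cE : u - G *m b = q^-1 *: c.
  rewrite {1}(orthogonal_row_mx_decomp uG c) -/q scalerDr scalerA mulVf ?gt_eqF//.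
  by rewrite scale1r /b mulmxN opprK -scalemxAr.
(* Dividing threshold and normal by [q > 0] preserves the event [A], and [G^T *m W = 0] because [W]
   is a multiple of [u]. *)
have /(Rz u u1) : quantile_minimizer P Z tau u G (a / q, b).
  apply: (quantile_minimizer_score Z_moments (A := A)) => //.
    by apply/seteqP; split => w /=; rewrite cE dotvZl mulrC ltr_pM2r ?invr_gt0.
  rewrite -/W (_ : W = Num.sqrt (dotv W W) *: u).
    by rewrite -scalemxAr (orthogonal_row_mx_cross uG) scaler0.
  by rewrite /u scalerA divff ?scale1r// gt_eqF// sqrtr_gt0.
rewrite /upper_halfspace /= -lerBrDl dotv_normal cE dotvZl [a / q]mulrC ler_pM2l ?invr_gt0//.
by rewrite leNgt za.
Qed.

End depth_regions.

Theorem theorem4p1 (R : realType) (k : nat) (d : measure_display)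
    (T : measurableType d) (P : probability T R) (Z : {RV P >-> 'cV[R]_k.+1})
    (Gamma : 'cV[R]_k.+1 -> 'M[R]_(k.+1, k))
    (Gamma_orth : forall u, unit_sphere u ->
       orthogonal_mx (row_mx u (Gamma u) : 'M[R]_k.+1))
    (f : 'cV[R]_k.+1 -> R)
    (Z_ac : distribution P Z `<< lebesgue_cV k.+1)
    (Z_density : is_density (distribution P Z) f)
    (f_connected : connected (density_support f))
    (Z_moments : forall i,
       P.-integrable setT (fun w => (Z w i ord0)%:E))
    (tau : R) (tau_range : 0 <= tau < 1) :
  quantile_region P Z Gamma tau = depth_region (distribution P Z) tau.
Proof.
case/andP: tau_range => tau_ge0 tau_lt1.
have [->|tau_neq0] := eqVneq tau 0.
  (* At order 0 both regions are the whole space, since every halfspace has nonnegative mass. *)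
  rewrite /quantile_region eqxx; apply/seteqP; split => // z _.
  by apply: le_ereal_inf_tmp => _ [H _ <-].
have tau01 : 0 < tau < 1 by rewrite lt0r tau_neq0 tau_ge0.
apply/seteqP; split; first exact: quantile_region_subset Z_density Z_moments _ tau01.
exact: depth_region_subset Z_density Z_moments _ tau01 f_connected.
Qed.
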